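(* Let $i:A\to X$ be a morphism of flows satisfying the S-homotopy extension property. Let $f:A\to Y$ be a morphism of flows. Consider the pushout in $\mathbf{Flow}$ $$\begin{array}{ccc}A & \xrightarrow{\ i\ } & X\\ {\scriptstyle f}\downarrow & & \downarrow\\ Y & \xrightarrow{\ j\ } & Z\end{array}$$ Then the canonical morphism $j:Y\to Z$ satisfies the S-homotopy extension property. In other terms, the pushout of a morphism of flows satisfying the S-homotopy extension property still satisfies the S-homotopy extension property.
   Context: $\mathbf{Top}$ is the category of compactly generated spaces (weak Hausdorff $k$-spaces) and continuous maps; all spaces are in $\mathbf{Top}$, and products and limits are taken in $\mathbf{Top}$. A flow $X$ consists of a space $\mathbb{P}X$ (path space), a discrete space $X^0$ ($0$-skeleton), continuous maps $s,t:\mathbb{P}X\to X^0$, and a continuous associative map $*:\{(x,y)\in \mathbb{P}X\times\mathbb{P}X;\ t(x)=s(y)\}\to\mathbb{P}X$ with $s(x*y)=s(x)$, $t(x*y)=t(y)$ (no identities are required). A morphism of flows $f:X\to Y$ is a set map $f^0:X^0\to Y^0$ together with a continuous map $\mathbb{P}f:\mathbb{P}X\to\mathbb{P}Y$ commuting with $s$, $t$ and $*$. It is synchronized if $f^0$ is a bijection. The category is $\mathbf{Flow}$ (complete and cocomplete). For a space $U$ and a flow $Y$, $\{U,Y\}_S$ is the flow with $0$-skeleton $Y^0$ and, for $\alpha,\beta\in Y^0$, space of paths from $\alpha$ to $\beta$ equal to $\mathbf{TOP}(U,\mathbb{P}_{\alpha,\beta}Y)$ (internal hom of $\mathbf{Top}$;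 $\mathbb{P}_{\alpha,\beta}Y$ is the subspace of paths with $s=\alpha$, $t=\beta$), with pointwise composition. The functor $\{U,-\}_S$ has a left adjoint $U\boxtimes -$. It is functorial in $U$ and $\{*\}\boxtimes X\cong X$; for $u\in U$, $u\boxtimes x$ denotes the image of $x\in X$ under $X\cong\{u\}\boxtimes X\to U\boxtimes X$. A synchronized morphism $i:A\to X$ satisfies the S-homotopy extension property if for every flow $Y$, every morphism $f:X\to Y$ and every morphism $h:[0,1]\boxtimes A\to Y$ with $h(0\boxtimes a)=f(i(a))$ for all $a\in A$, there is a morphism $H:[0,1]\boxtimes X\to Y$ with $H(0\boxtimes x)=f(x)$ for all $x\in X$ and $H(t\boxtimes i(a))=h(t\boxtimes a)$ for all $(t,a)\in[0,1]\times A$. *)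

(* Defs.v *)
From HB Require Import structures.
From mathcomp Require Import all_boot all_order all_algebra generic_quotient.
From mathcomp Require Import all_classical all_reals.
From mathcomp Require Import topology normedtype.

Set Implicit Arguments.
Unset Strict Implicit.
Unset Printing Implicit Defensive.

Import Order.TTheory GRing.Theory Num.Theory.
Import numFieldNormedType.Exports.
Local Open Scope classical_set_scope.

Definition compact_hausdorff (K : topologicalType) : Prop :=
  compact [set: K] /\ hausdorff_space K.

Definition k_open (T : topologicalType) (A : set T) : Prop :=
  forall (K : topologicalType) (c : K -> T),
    compact_hausdorff K -> continuous c -> open (c @^-1` A).

Definition k_space (T : topologicalType) : Prop :=
  forall A : set T, k_open A -> open A.

Definition weak_hausdorff (T : topologicalType) : Prop :=
  forall (K : topologicalType) (c : K -> T),
    compact_hausdorff K -> continuous c -> closed (range c).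

Record cgSpace := CGSpace {
  cg_sort :> topologicalType;
  cg_kspace : k_space cg_sort;
  cg_wh : weak_hausdorff cg_sort
}.

(** A form of weak Hausdorffness that is visibly inherited along
    point-separating families of maps, and that is equivalent to it for
    k-spaces ([k_diagonal_wh], [wh_k_diagonal]). *)
Definition k_diagonal (T : topologicalType) : Prop :=
  forall (K : topologicalType) (f g : K -> T),
    compact_hausdorff K -> continuous f -> continuous g ->
    closed [set k | f k = g k].

Lemma continuous_open (T U : topologicalType) (f : T -> U) :
  continuous f -> forall A, open A -> open (f @^-1` A).
Proof. by move/continuousP. Qed.

Lemma continuous_compose (T U V : topologicalType) (f : T -> U) (g : U -> V) :
  continuous f -> continuous g -> continuous (fun x => g (f x)).
Proof. by move=> cf cg x; apply: continuous_comp; [exact: cf|exact: cg]. Qed.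

Lemma continuous_pair (T U V : topologicalType) (f : T -> U) (g : T -> V) :
  continuous f -> continuous g -> continuous (fun x => (f x, g x)).
Proof. by move=> cf cg x; apply: cvg_pair; [exact: cf|exact: cg]. Qed.

Lemma compact_hausdorff_prod (K L : topologicalType) :
  compact_hausdorff K -> compact_hausdorff L -> compact_hausdorff (K * L)%type.
Proof.
move=> [cK hK] [cL hL]; split; first by rewrite -setXTT; exact: compact_setX.
have nX (A : set K) (B : set L) x : nbhs x.1 A -> nbhs x.2 B ->
    nbhs x (A `*` B).
  by move=> nA nB; exists (A, B).
move=> [a b] [c d] /= H.
have e1 : a = c.
  apply: hK => A B nA nB.
  have [||[x y] [/= [? _] [? _]]] := H (A `*` setT) (B `*` setT); last by exists x.
    by apply: nX => //; exact: filterT.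
  by apply: nX => //; exact: filterT.
have e2 : b = d.
  apply: hL => A B nA nB.
  have [||[x y] [/= [_ ?] [_ ?]]] := H (setT `*` A) (setT `*` B); last by exists y.
    by apply: nX => //; exact: filterT.
  by apply: nX => //; exact: filterT.
by rewrite e1 e2.
Qed.

Lemma val_continuous (T : topologicalType) (A : set T) :
  continuous (val : A -> T).
Proof. exact: initial_continuous. Qed.

Lemma compact_hausdorff_set_type (T : topologicalType) (N : set T) :
  hausdorff_space T -> compact N -> compact_hausdorff (set_type N).
Proof.
move=> hT cN; split.
  move=> F PF _.
  have [|p [Np clp]] := cN ((val : N -> T) @ F).
    rewrite /fmap /=; apply: (@filterS _ F _ setT); last exact: filterT.
    by move=> [x xN] _; exact: (set_mem xN).
  exists (exist _ p (mem_set Np)); split => // A B FA [W' [[W oW <-]] /= Wp sWB].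
  have [] := clp ((val : N -> T) @` A) W.
  - by rewrite /fmap /=; apply: filterS FA => x Ax; exists x.
  - by apply: open_nbhs_nbhs; split => //; exact: Wp.
  by move=> _ [[x Ax <-] Wx]; exists x; split => //; exact: sWB.
move=> x y H; apply: val_inj; apply: hT => A B nA nB.
have cv := @val_continuous T N.
have [z [Az Bz]] := H _ _ (cv x _ nA) (cv y _ nB).
by exists (val z).
Qed.

Lemma sub_continuous (S T : topologicalType) (A : set T) (f : S -> A) :
  continuous (fun x => val (f x)) -> continuous f.
Proof. by move=> cf; apply: (@continuous_comp_initial A S T set_val f). Qed.

Lemma compact_hausdorff_k_space (K : topologicalType) :
  compact_hausdorff K -> k_space K.
Proof. by move=> cK A kA; apply: (kA K id cK) => x. Qed.

Lemma compact_hausdorff_wh (K : topologicalType) :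
  compact_hausdorff K -> weak_hausdorff K.
Proof.
move=> [cK hK] L c [cL hL] cc; apply: compact_closed => //.
apply: continuous_compact => //; exact: continuous_subspaceT.
Qed.

Lemma k_space_continuous (S T : topologicalType) (f : S -> T) :
  k_space S ->
  (forall (K : topologicalType) (c : K -> S), compact_hausdorff K ->
     continuous c -> continuous (fun x => f (c x))) ->
  continuous f.
Proof.
move=> kS H; apply/continuousP => A oA; apply: kS => K c cK cc.
exact: (continuous_open (H K c cK cc)).
Qed.

Lemma k_diagonal_wh (T : topologicalType) :
  k_space T -> k_diagonal T -> weak_hausdorff T.
Proof.
move=> kT dT K c cK cc; rewrite -openC; apply: kT => L d cL cd.
rewrite preimage_setC openC.
have cKL := compact_hausdorff_prod cK cL.
have cE : closed [set x : K * L | c x.1 = d x.2].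
  apply: (dT _ (fun x => c x.1) (fun x => d x.2)) => //.
    by apply: continuous_compose cc => x; exact: cvg_fst.
  by apply: continuous_compose cd => x; exact: cvg_snd.
have E : d @^-1` range c = snd @` [set x : K * L | c x.1 = d x.2].
  apply/seteqP; split => l /=; first by case=> k _ e; exists (k, l).
  by case=> -[k l'] /= e <-; exists k.
suff : closed (d @^-1` range c) by [].
rewrite E; apply: compact_closed; first exact: cL.2.
apply: continuous_compact; last first.
  by apply: (subclosed_compact cE cKL.1).
by apply: continuous_subspaceT => x; exact: cvg_snd.
Qed.

Lemma wh_k_diagonal (T : topologicalType) : weak_hausdorff T -> k_diagonal T.
Proof.
move=> wT K f g cK cf cg; rewrite -openC openE => k0 /= ne.
have cl1 : closed [set g k0].
  have -> : [set g k0] = range (fun _ : K => g k0).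
    by apply/seteqP; split => x /=; [move=> ->; exists k0|case].
  by apply: wT => //; exact: cst_continuous.
have nb : nbhs k0 (f @^-1` ~` [set g k0]).
  apply: open_nbhs_nbhs; split; last exact: ne.
  by apply: (continuous_open cf); rewrite openC.
have [B nB sB] : exists2 B, nbhs k0 B &
    closure B `<=` f @^-1` ~` [set g k0].
  have [|B ? ?] := @compact_regular K k0 setT cK.2 cK.1 _ _ nb; last by exists B.
  exact: filterT.
pose N := closure B.
have cN : compact_hausdorff (set_type N).
  apply: compact_hausdorff_set_type; first exact: cK.2.
  exact: (subclosed_compact (@closed_closure _ B) cK.1).
have clfN : closed (range (fun x : N => f (val x))).
  by apply: wT => //; apply: continuous_compose cf; exact: val_continuous.
have n2 : nbhs k0 (g @^-1` ~` range (fun x : N => f (val x))).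
  apply: open_nbhs_nbhs; split.
    by apply: (continuous_open cg); rewrite openC.
  by move=> [x _ e]; apply: (sB (val x)); [exact: (set_valP x)|exact: e].
apply: filterS (filterI nB n2) => k [Bk gk] /= e; apply: gk.
by exists (exist _ k (mem_set (subset_closure Bk))).
Qed.

Lemma cg_k_diagonal (X : cgSpace) : k_diagonal X.
Proof. by apply: wh_k_diagonal; exact: cg_wh. Qed.

Lemma k_diagonal_sep (T : topologicalType) :
  (forall x y : T, x <> y -> exists (X : topologicalType) (f : T -> X),
     [/\ k_diagonal X, continuous f & f x <> f y]) ->
  k_diagonal T.
Proof.
move=> sep K f g cK cf cg; rewrite -openC openE => k0 /= ne.
have [X [p [dX cp np]]] := sep _ _ ne.
have cE : closed [set k | p (f k) = p (g k)].
  by apply: dX => //; exact: continuous_compose cp.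
have : nbhs k0 (~` [set k | p (f k) = p (g k)]).
  by apply: open_nbhs_nbhs; split => //; rewrite openC.
by apply: filterS => k /= h e; apply: h; rewrite e.
Qed.

Definition kify (T : Type) : Type := T.

Section kify.
Variable T : topologicalType.

Let k_openT : k_open [set: T].
Proof. by move=> K c _ _; rewrite preimage_setT; exact: openT. Qed.

Let k_openI : setI_closed (@k_open T).
Proof.
by move=> A B kA kB K c cK cc; apply: openI; [exact: kA|exact: kB].
Qed.

Let k_open_bigU (I : Type) (f : I -> set T) :
  (forall i, k_open (f i)) -> k_open (\bigcup_i f i).
Proof.
move=> kf K c cK cc; rewrite preimage_bigcup.
by apply: bigcup_open => i _; exact: kf.
Qed.

HB.instance Definition _ := Choice.copy (kify T) T.
HB.instance Definition _ :=
  isOpenTopological.Build (kify T) k_openT k_openI k_open_bigU.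

Lemma kify_openE (A : set (kify T)) : open A = k_open (A : set T).
Proof. by []. Qed.

Lemma of_kify_continuous : continuous (id : kify T -> T).
Proof.
by apply/continuousP => A oA; rewrite kify_openE => K c _ cc;
   exact: (continuous_open cc).
Qed.

Lemma to_kify_continuous (S : topologicalType) (f : S -> T) :
  k_space S -> continuous f -> continuous (f : S -> kify T).
Proof.
move=> kS cf; apply/continuousP => A; rewrite kify_openE => kA.
by apply: kS => K c cK cc; apply: kA => //; exact: continuous_compose cf.
Qed.

Lemma kify_k_space : k_space (kify T).
Proof.
move=> A kA; rewrite kify_openE => K c cK cc; apply: kA => //.
by apply: to_kify_continuous => //; exact: compact_hausdorff_k_space.
Qed.

Lemma kify_k_diagonal : k_diagonal T -> k_diagonal (kify T).
Proof.
move=> dT K f g cK cf cg; apply: dT => //.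
  exact: (continuous_compose cf of_kify_continuous).
exact: (continuous_compose cg of_kify_continuous).
Qed.

Definition cg_kify (dT : k_diagonal T) : cgSpace :=
  CGSpace kify_k_space (k_diagonal_wh kify_k_space (kify_k_diagonal dT)).

End kify.

Lemma discrete_k_diagonal (T : discreteTopologicalType) : k_diagonal T.
Proof.
move=> K f g cK cf cg.
have -> : [set k | f k = g k] = (fun k => (f k, g k)) @^-1` [set x | x.1 = x.2].
  by [].
apply: preimage_closed => [x _|]; first exact: continuous_pair.
rewrite -openC openE => -[a b] /= ne; exists ([set a], [set b]).
  by split => /=; [exact: (@discrete_set1 T a)|exact: (@discrete_set1 T b)].
by move=> [c d] [/= -> ->].
Qed.

Lemma discrete_k_space (T : discreteTopologicalType) : k_space T.
Proof. by move=> A _; exact: discrete_open. Qed.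

Definition cg_discrete (T : discreteTopologicalType) : cgSpace :=
  CGSpace (@discrete_k_space T)
    (k_diagonal_wh (@discrete_k_space T) (@discrete_k_diagonal T)).

Definition cg_point : cgSpace := cg_discrete (discrete_topology unit).

Section interval.
Variable R : realType.

Lemma interval_compact_hausdorff :
  compact_hausdorff (set_type (`[0%R, 1%R] : set R)).
Proof.
by apply: compact_hausdorff_set_type; [exact: Rhausdorff|exact: segment_compact].
Qed.

Definition cg_interval : cgSpace :=
  CGSpace (compact_hausdorff_k_space interval_compact_hausdorff)
    (compact_hausdorff_wh interval_compact_hausdorff).

Lemma zero_in_interval : (0%R : R) \in (`[0%R, 1%R]%classic : set R).
Proof. by rewrite inE /= in_itv /= lexx ler01. Qed.

Definition interval0 : cg_interval := exist _ 0%R zero_in_interval.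

End interval.

Lemma prod_k_diagonal (X Y : cgSpace) : k_diagonal (X * Y)%type.
Proof.
apply: k_diagonal_sep => -[a b] [c d] ne.
have [e|n1] := pselect (a = c).
  exists Y, snd; split; first exact: cg_k_diagonal.
    by move=> x; exact: cvg_snd.
  by move=> /= e2; apply: ne; rewrite e e2.
exists X, fst; split => //; first exact: cg_k_diagonal.
by move=> x; exact: cvg_fst.
Qed.

Definition cg_prod (X Y : cgSpace) : cgSpace := cg_kify (@prod_k_diagonal X Y).

Lemma sub_k_diagonal (X : cgSpace) (A : set X) : k_diagonal (set_type A).
Proof.
apply: k_diagonal_sep => x y ne; exists X, val; split.
- exact: cg_k_diagonal.
- exact: val_continuous.
by move=> /val_inj.
Qed.

Definition cg_sub (X : cgSpace) (A : set X) : cgSpace :=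
  cg_kify (@sub_k_diagonal X A).

Section prod_sub.
Variables (S X Y : cgSpace).

Lemma cg_fst_continuous : continuous (fun p : cg_prod X Y => p.1 : X).
Proof.
apply: (continuous_compose (@of_kify_continuous (X * Y)%type)) => x.
exact: cvg_fst.
Qed.

Lemma cg_snd_continuous : continuous (fun p : cg_prod X Y => p.2 : Y).
Proof.
apply: (continuous_compose (@of_kify_continuous (X * Y)%type)) => x.
exact: cvg_snd.
Qed.

Lemma cg_pair_continuous (f : S -> X) (g : S -> Y) :
  continuous f -> continuous g ->
  continuous (fun s => (f s, g s) : cg_prod X Y).
Proof.
move=> cf cg; apply: to_kify_continuous; first exact: cg_kspace.
exact: continuous_pair.
Qed.

Lemma cg_val_continuous (A : set X) :
  continuous (fun p : cg_sub A => val (p : A) : X).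
Proof.
apply: (continuous_compose (@of_kify_continuous (set_type A))).
exact: val_continuous.
Qed.

Lemma cg_sub_continuous (A : set X) (f : S -> cg_sub A) :
  continuous (fun x => val (f x : A)) -> continuous f.
Proof.
move=> cf; apply: to_kify_continuous; first exact: cg_kspace.
exact: sub_continuous.
Qed.

End prod_sub.

(** The internal hom: the k-ification of the compact-open topology on the set
    of continuous maps. It satisfies the exponential law for [cg_prod]
    ([cg_curry_continuous], [cg_uncurry_continuous]). *)
Definition compact_open_maps (U V : topologicalType) : Type :=
  initial_topology
    (fun f : continuousType U V => (f : U -> V) : {compact-open, U -> V}).
HB.instance Definition _ (U V : topologicalType) :=
  Topological.on (compact_open_maps U V).

Lemma compact_open_eval_continuous (U V : topologicalType) (u : U) :
  continuous (fun f : compact_open_maps U V => (f : continuousType U V) u).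
Proof.
apply/continuousP => O oO.
exists [set g : {compact-open, U -> V} | g @` [set u] `<=` O].
  exact: (compact_open_open (@compact_set1 _ u) oO).
by apply/seteqP; split => f /= H; [apply: H; exists u|move=> _ [_ -> <-]].
Qed.

Lemma fun_k_diagonal (U V : cgSpace) : k_diagonal (compact_open_maps U V).
Proof.
apply: k_diagonal_sep => f g ne.
have [u nu] : exists u, (f : continuousType U V) u <> (g : continuousType U V) u.
  apply: contrapT => /forallNP H; apply: ne; apply/continuousEP => u.
  exact: contrapT.
exists V, (fun f => (f : continuousType U V) u); split => //.
  exact: cg_k_diagonal.
exact: compact_open_eval_continuous.
Qed.

Definition cg_fun (U V : cgSpace) : cgSpace := cg_kify (@fun_k_diagonal U V).

Definition cg_eval (U V : cgSpace) (f : cg_fun U V) : U -> V :=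
  (f : continuousType U V).

Lemma cg_eval_cts (U V : cgSpace) (f : cg_fun U V) : continuous (cg_eval f).
Proof. by move=> x; exact: cts_fun. Qed.

Definition cg_mk (U V : cgSpace) (f : U -> V) (cf : continuous f) : cg_fun U V :=
  mkcts cf : continuousType U V.

Lemma cg_mkE (U V : cgSpace) (f : U -> V) (cf : continuous f) u :
  cg_eval (cg_mk cf) u = f u.
Proof. by []. Qed.

Lemma compact_hausdorff_locally_compact (K : topologicalType) :
  compact_hausdorff K -> locally_compact [set: K].
Proof.
move=> cK x _; exists setT; first by rewrite withinET; exact: filterT.
by split; [exact: cK.1|exact: closedT].
Qed.

Lemma compact_open_precomp_continuous (S K U V : topologicalType)
    (f : S -> continuousType U V) (c : K -> U) :
  continuous (f : S -> compact_open_maps U V) -> continuous c ->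
  continuous (fun s => (fun k => f s (c k)) : {compact-open, K -> V}).
Proof.
move=> cf cc s; apply/compact_open_cvgP => C O cC oO sCO.
have cC' : compact (c @` C).
  by apply: continuous_compact => //; exact: continuous_subspaceT.
have := continuous_open (@initial_continuous _ _
   (fun f : continuousType U V => (f : U -> V) : {compact-open, U -> V}))
   (compact_open_open cC' oO).
move/(continuous_open cf) => oN.
have : nbhs s ((f : S -> compact_open_maps U V) @^-1`
   ((fun f : continuousType U V => (f : U -> V)) @^-1`
    [set g | g @` (c @` C) `<=` O])).
  apply: open_nbhs_nbhs; split => //= _ [_ [k Ck <-] <-].
  by apply: sCO; exists k.
apply: filterS => s' /= H _ [k Ck <-]; apply: H.
by exists (c k) => //; exists k.
Qed.

Lemma cg_uncurry_continuous (U V : cgSpace) :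
  continuous (fun p : cg_prod (cg_fun U V) U => cg_eval p.1 p.2 : V).
Proof.
apply: k_space_continuous => [|K c cK cc]; first exact: cg_kspace.
have ca := continuous_compose cc (@cg_fst_continuous (cg_fun U V) U).
have cb := continuous_compose cc (@cg_snd_continuous (cg_fun U V) U).
have ca' := continuous_compose ca (@of_kify_continuous (compact_open_maps U V)).
have := compact_open_precomp_continuous ca' cb.
set F := (fun s => _) => cF.
have cu : continuous (uncurry (F : K -> K -> V)).
  apply: continuous_uncurry => //.
  - exact: compact_hausdorff_locally_compact.
  - exact: cK.2.
  by move=> k; apply: (continuous_compose cb); exact: cts_fun.
apply: (@continuous_compose _ _ _ (fun k : K => (k, k)) _ _ cu).
by apply: continuous_pair => x.
Qed.

Lemma cg_prod_compact_continuous (L U : topologicalType) (V : topologicalType)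
    (F : L -> U -> V) :
  compact_hausdorff L -> k_space U ->
  (forall (C : topologicalType) (c : C -> U), compact_hausdorff C ->
     continuous c -> continuous (fun p : L * C => F p.1 (c p.2))) ->
  continuous (fun p : L * U => F p.1 p.2).
Proof.
move=> cL kU H.
pose G : U -> {compact-open, L -> V} := fun u l => F l u.
have cG : continuous G.
  apply: k_space_continuous => // C c cC cc.
  have Hs : continuous (fun p : C * L => F p.2 (c p.1)).
    apply: (@continuous_compose _ _ _ (fun p : C * L => (p.2, p.1)) _ _ (H C c cC cc)).
    by apply: continuous_pair => x; [exact: cvg_snd|exact: cvg_fst].
  exact: (continuous_curry_fun Hs).
have cGu u : continuous (G u).
  have cd : continuous (fun l : L => (l, l)) by apply: continuous_pair => x.
  exact: (continuous_compose cd (H L (fun=> u) cL (@cst_continuous _ _ u))).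
have cu : continuous (uncurry (G : U -> L -> V)).
  apply: continuous_uncurry => //; last exact: cL.2.
  exact: compact_hausdorff_locally_compact.
apply: (@continuous_compose _ _ _ (fun p : L * U => (p.2, p.1)) _ _ cu).
by apply: continuous_pair => x; [exact: cvg_snd|exact: cvg_fst].
Qed.

Lemma cg_curry_continuous (S U V : cgSpace) (g : S -> cg_fun U V) :
  continuous (fun p : cg_prod S U => cg_eval (g p.1) p.2 : V) -> continuous g.
Proof.
move=> cg; apply: to_kify_continuous; first exact: cg_kspace.
apply: k_space_continuous => [|L d cL cd]; first exact: cg_kspace.
apply: (@continuous_comp_initial (continuousType U V) L {compact-open, U -> V}).
have H : continuous (fun p : L * U => cg_eval (g (d p.1)) p.2 : V).
  apply: (@cg_prod_compact_continuous L U V (fun l u => cg_eval (g (d l)) u)) => //.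
    exact: cg_kspace.
  move=> C c cC cc.
  have cLC := compact_hausdorff_prod cL cC.
  pose LC := CGSpace (compact_hausdorff_k_space cLC) (compact_hausdorff_wh cLC).
  apply: (@continuous_compose LC (cg_prod S U) V
           (fun p : L * C => (d p.1, c p.2)) _ _ cg).
  apply: (@cg_pair_continuous LC) => /=.
    by apply: (continuous_compose _ cd) => x; exact: cvg_fst.
  by apply: (continuous_compose _ cc) => x; exact: cvg_snd.
exact: (continuous_curry_fun H).
Qed.

Section sigma.
Variables (I : choiceType) (X : I -> cgSpace).

Let T : topologicalType := {i : I & (X i : topologicalType)}.

Lemma sigma_k_space : k_space T.
Proof.
move=> A kA; apply/sigT_openP => i; apply: cg_kspace => K c cK cc.
apply: (kA K (fun k => existT _ i (c k))) => //.
by apply: (continuous_compose cc); exact: existT_continuous.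
Qed.

Lemma sigma_continuous (Z : topologicalType) (f : T -> Z) :
  (forall i, continuous (fun x : X i => f (existT _ i x))) -> continuous f.
Proof.
move=> H; apply/continuousP => A oA; apply/sigT_openP => i.
exact: (continuous_open (H i)).
Qed.

Lemma projT1_continuous : continuous (@projT1 I _ : T -> discrete_topology I).
Proof. by apply: sigma_continuous => i /=; exact: cst_continuous. Qed.

Definition sigma_retract (i : I) (x0 : X i) (p : T) : X i :=
  match pselect (projT1 p = i) with
  | left e => ecast j (X j) e (projT2 p)
  | right _ => x0
  end.

Lemma sigma_retractE (i : I) (x0 x : X i) :
  sigma_retract x0 (existT _ i x) = x.
Proof.
rewrite /sigma_retract /=; case: pselect => [e|//].
by rewrite (Prop_irrelevance e erefl).
Qed.

Lemma sigma_retract_neq (i : I) (x0 : X i) p :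
  projT1 p <> i -> sigma_retract x0 p = x0.
Proof. by rewrite /sigma_retract; case: pselect. Qed.

Lemma sigma_retract_continuous (i : I) (x0 : X i) :
  continuous (sigma_retract x0).
Proof.
apply: sigma_continuous => j.
have [e|ne] := pselect (j = i).
  move: x0; case: _ / e => x0.
  rewrite (_ : (fun x => _) = id); first by move=> x.
  by apply/funext => x; rewrite sigma_retractE.
rewrite (_ : (fun x => _) = fun=> x0); first exact: cst_continuous.
by apply/funext => x; rewrite sigma_retract_neq.
Qed.

Lemma sigma_k_diagonal : k_diagonal T.
Proof.
apply: k_diagonal_sep => -[i x] [j y] ne.
have [e|nij] := pselect (i = j); last first.
  exists (discrete_topology I), (@projT1 I _); split => //.
    exact: discrete_k_diagonal.
  exact: projT1_continuous.
move: x ne; case: _ / e y => y x ne.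
exists (X i), (sigma_retract x); split.
- exact: cg_k_diagonal.
- exact: sigma_retract_continuous.
by rewrite !sigma_retractE => e; apply: ne; rewrite e.
Qed.

Definition cg_sigma : cgSpace :=
  CGSpace sigma_k_space (k_diagonal_wh sigma_k_space sigma_k_diagonal).

End sigma.

Lemma near_eq_continuous (T U : topologicalType) (f g : T -> U) (x : T) :
  (\forall y \near x, g y = f y) -> {for x, continuous g} ->
  {for x, continuous f}.
Proof.
move=> H cg A; rewrite -(nbhs_singleton H) => /cg nA.
by apply: filterS (filterI H nA) => y [e Ay]; rewrite /= -e.
Qed.

Lemma continuous_discrete_near (T : topologicalType)
    (D : discreteTopologicalType) (f : T -> D) (x : T) :
  continuous f -> \forall y \near x, f y = f x.
Proof. by move=> cf; apply: (cf x [set f x]); exact: discrete_set1. Qed.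

Lemma discrete_dom_continuous (D : discreteTopologicalType)
    (T : topologicalType) (f : D -> T) : continuous f.
Proof.
move=> x A /nbhs_singleton Afx; apply: filterS (discrete_set1 x).
by move=> _ ->.
Qed.

(** The subspace of composable pairs of the product in the category of compactly
    generated spaces; [pcomp] below is continuous on that space. *)
Section composable.
Variables (P : cgSpace) (S : discreteTopologicalType) (s t : P -> S).

Definition cg_composable : cgSpace :=
  cg_sub [set xy : cg_prod P P | t xy.1 = s xy.2].

Definition compair (x y : P) (h : t x = s y) : cg_composable :=
  exist _ (x, y) (mem_set h : (x, y) \in [set xy : cg_prod P P | t xy.1 = s xy.2]).

Definition cfst (p : cg_composable) : P := (val (p : set_type _)).1.
Definition csnd (p : cg_composable) : P := (val (p : set_type _)).2.

Lemma composableP (p : cg_composable) : t (cfst p) = s (csnd p).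
Proof. by case: p => p pP; exact: (set_mem pP). Qed.

Lemma compair_eta (p : cg_composable) (h : t (cfst p) = s (csnd p)) :
  p = compair h.
Proof. by apply: val_inj; case: p h => -[]. Qed.

Lemma compair_eq (x y x' y' : P) (h : t x = s y) (h' : t x' = s y') :
  x = x' -> y = y' -> compair h = compair h'.
Proof. by move=> ex ey; apply: val_inj => /=; rewrite ex ey. Qed.

Lemma cfst_continuous : continuous cfst.
Proof.
apply: (continuous_compose (@cg_val_continuous _ _)); exact: cg_fst_continuous.
Qed.

Lemma csnd_continuous : continuous csnd.
Proof.
apply: (continuous_compose (@cg_val_continuous _ _)); exact: cg_snd_continuous.
Qed.

Lemma composable_continuous (T : cgSpace) (f : T -> cg_composable) :
  continuous (fun x => cfst (f x)) -> continuous (fun x => csnd (f x)) ->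
  continuous f.
Proof.
move=> c1 c2; apply: cg_sub_continuous.
rewrite (_ : (fun x => _) = fun x => (cfst (f x), csnd (f x)) : cg_prod P P).
  exact: cg_pair_continuous.
by apply/funext => x; rewrite /cfst /csnd -surjective_pairing.
Qed.

Lemma compair_continuous (T : cgSpace) (f g : T -> P)
    (h : forall x, t (f x) = s (g x)) :
  continuous f -> continuous g -> continuous (fun x => compair (h x)).
Proof. by move=> cf cg; apply: composable_continuous. Qed.

End composable.

Record flow := Flow {
  path : cgSpace;
  state : discreteTopologicalType;
  src : path -> state;
  tgt : path -> state;
  pcomp : cg_composable src tgt -> path;
  src_continuous : continuous src;
  tgt_continuous : continuous tgt;
  pcomp_continuous : continuous pcomp;
  src_pcomp : forall x y (h : tgt x = src y), src (pcomp (compair h)) = src x;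
  tgt_pcomp : forall x y (h : tgt x = src y), tgt (pcomp (compair h)) = tgt y;
  pcompA : forall x y z (hxy : tgt x = src y) (hyz : tgt y = src z)
    (hxy_z : tgt (pcomp (compair hxy)) = src z)
    (hx_yz : tgt x = src (pcomp (compair hyz))),
    pcomp (compair hxy_z) = pcomp (compair hx_yz)
}.

Definition pconcat (X : flow) (x y : path X) (h : tgt x = src y) : path X :=
  pcomp (compair h).

Lemma pconcat_eq (X : flow) (x y x' y' : path X) (h : tgt x = src y)
    (h' : tgt x' = src y') :
  x = x' -> y = y' -> pconcat h = pconcat h'.
Proof. by move=> ex ey; rewrite /pconcat (compair_eq h h' ex ey). Qed.

Record flow_mor (X Y : flow) := FlowMor {
  fstate : state X -> state Y;
  fpath : path X -> path Y;
  fpath_continuous : continuous fpath;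
  src_fpath : forall x, src (fpath x) = fstate (src x);
  tgt_fpath : forall x, tgt (fpath x) = fstate (tgt x);
  fpath_pconcat : forall x y (h : tgt x = src y)
    (h' : tgt (fpath x) = src (fpath y)), fpath (pconcat h) = pconcat h'
}.

Arguments fpath_continuous {X Y} f.
Arguments fpath_pconcat {X Y} f {x y} h h'.

Lemma flow_mor_eq (X Y : flow) (f g : flow_mor X Y) :
  fstate f =1 fstate g -> fpath f =1 fpath g -> f = g.
Proof.
case: f g => [f0 f1 ? ? ? ?] [g0 g1 ? ? ? ?] /= /funext e0 /funext e1.
by subst; congr FlowMor; exact: Prop_irrelevance.
Qed.

Section id_comp.
Variables (X Y Z : flow) (g : flow_mor Y Z) (f : flow_mor X Y).

Definition flow_id : flow_mor X X.
Proof.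
refine (@FlowMor X X id id _ _ _ _) => //; first by move=> x.
by move=> x y h h'; exact: pconcat_eq.
Defined.

Definition flow_comp : flow_mor X Z.
Proof.
refine (@FlowMor X Z (fun a => fstate g (fstate f a))
  (fun x => fpath g (fpath f x)) _ _ _ _).
- by apply: (continuous_compose (fpath_continuous f));
    exact: fpath_continuous.
- by move=> x; rewrite !src_fpath.
- by move=> x; rewrite !tgt_fpath.
move=> x y h h'.
have h1 : tgt (fpath f x) = src (fpath f y) by rewrite tgt_fpath src_fpath h.
by rewrite (fpath_pconcat f h h1) (fpath_pconcat g h1 h').
Defined.

End id_comp.

Definition paths_between (Y : flow) (a b : state Y) : cgSpace :=
  cg_sub [set p : path Y | src p = a /\ tgt p = b].

(** [fexp U Y] is the flow {U, Y}_S: its path space is the disjoint union over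
    pairs of states of the internal homs into the spaces [paths_between]. *)
Section fexp.
Variables (U : cgSpace) (Y : flow).

Definition fexp_path : cgSpace :=
  cg_sigma (fun ab : state Y * state Y =>
    cg_fun U (paths_between ab.1 ab.2)).

Definition fexp_src (p : fexp_path) : state Y := (projT1 p).1.
Definition fexp_tgt (p : fexp_path) : state Y := (projT1 p).2.

Definition fexp_eval (p : fexp_path) (u : U) : path Y :=
  val (cg_eval (projT2 p) u : set_type _).

Lemma src_fexp_eval p u : src (fexp_eval p u) = fexp_src p.
Proof. by rewrite /fexp_eval; case: (cg_eval _ _) => q /= /set_mem []. Qed.

Lemma tgt_fexp_eval p u : tgt (fexp_eval p u) = fexp_tgt p.
Proof. by rewrite /fexp_eval; case: (cg_eval _ _) => q /= /set_mem []. Qed.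

Lemma fexp_path_eq (p q : fexp_path) :
  fexp_src p = fexp_src q -> fexp_tgt p = fexp_tgt q ->
  fexp_eval p =1 fexp_eval q -> p = q.
Proof.
case: p q => [[a b] f] [[c d] g]; rewrite /fexp_src /fexp_tgt /=.
move=> e1 e2; case: _ / e1 g => g; case: _ / e2 g => g H.
congr existT; apply/continuousEP => u; apply: val_inj; exact: H.
Qed.

Lemma fexp_src_continuous : continuous fexp_src.
Proof.
apply: (continuous_compose (@projT1_continuous _ _)).
exact: (@discrete_dom_continuous (discrete_topology (state Y * state Y)%type)).
Qed.

Lemma fexp_tgt_continuous : continuous fexp_tgt.
Proof.
apply: (continuous_compose (@projT1_continuous _ _)).
exact: (@discrete_dom_continuous (discrete_topology (state Y * state Y)%type)).
Qed.

Lemma fexp_near_tag (S : topologicalType) (f : S -> fexp_path) (x : S) :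
  continuous (fun y => fexp_src (f y)) ->
  continuous (fun y => fexp_tgt (f y)) ->
  \forall y \near x, projT1 (f y) = projT1 (f x).
Proof.
move=> c1 c2.
have [n1 n2] := (continuous_discrete_near x c1, continuous_discrete_near x c2).
apply: filterS (filterI n1 n2) => y [].
rewrite /fexp_src /fexp_tgt.
by case: (projT1 (f y)) (projT1 (f x)) => [? ?] [? ?] /= -> ->.
Qed.

Lemma fexp_eval_sigma_retract (x0 p : fexp_path) u : projT1 p = projT1 x0 ->
  val (cg_eval (sigma_retract (projT2 x0) p) u : set_type _) = fexp_eval p u.
Proof.
case: p x0 => [ab f] [cd g] /= e; case: _ / e g => g.
by rewrite sigma_retractE.
Qed.

Lemma fexp_eval_continuous :
  continuous (fun p : cg_prod fexp_path U => fexp_eval p.1 p.2).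
Proof.
move=> p0.
have c1 := @cg_fst_continuous fexp_path U.
have c2 := @cg_snd_continuous fexp_path U.
apply: (@near_eq_continuous _ _ _ (fun p : cg_prod fexp_path U =>
  val (cg_eval (sigma_retract (projT2 p0.1) p.1) p.2 : set_type _))).
  have := @fexp_near_tag (cg_prod fexp_path U) fst p0
    (continuous_compose c1 fexp_src_continuous)
    (continuous_compose c1 fexp_tgt_continuous).
  by apply: filterS => p e; exact: fexp_eval_sigma_retract.
pose x0 := projT2 p0.1.
have cr : continuous (fun p : cg_prod fexp_path U =>
    (sigma_retract x0 p.1, p.2) : cg_prod (cg_fun U (paths_between _ _)) U).
  apply: cg_pair_continuous => //.
  exact: (continuous_compose c1 (@sigma_retract_continuous _ _ _ x0)).
apply: (continuous_compose _ (@cg_val_continuous _ _)).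
exact: (continuous_compose cr (@cg_uncurry_continuous _ _)).
Qed.

Lemma fexp_eval_comp_continuous (S : cgSpace) (f : S -> fexp_path) (g : S -> U) :
  continuous f -> continuous g -> continuous (fun x => fexp_eval (f x) (g x)).
Proof.
move=> cf cg; exact: (continuous_compose (cg_pair_continuous cf cg)
  fexp_eval_continuous).
Qed.

Lemma fexp_eval_cts (p : fexp_path) : continuous (fexp_eval p).
Proof.
apply: (continuous_compose _ (@cg_val_continuous _ _)).
exact: cg_eval_cts.
Qed.

Lemma fexp_path_continuous (S : cgSpace) (f : S -> fexp_path) :
  continuous (fun x => fexp_src (f x)) ->
  continuous (fun x => fexp_tgt (f x)) ->
  continuous (fun p : cg_prod S U => fexp_eval (f p.1) p.2) ->
  continuous f.
Proof.
move=> c1 c2 c3 x0.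
pose g x := sigma_retract (projT2 (f x0)) (f x).
have near0 := fexp_near_tag x0 c1 c2.
apply: (@near_eq_continuous _ _ f (fun x => existT _ (projT1 (f x0)) (g x) : fexp_path)).
  apply: filterS near0 => x e; apply: fexp_path_eq.
  - by rewrite /fexp_src e.
  - by rewrite /fexp_tgt e.
  move=> u; rewrite -(fexp_eval_sigma_retract u e); by [].
suff cg : continuous g by apply: (continuous_compose cg); exact: existT_continuous.
apply: cg_curry_continuous; apply: cg_sub_continuous.
move=> [x u].
have [e|ne] := pselect (projT1 (f x) = projT1 (f x0)).
  apply: (@near_eq_continuous _ _ _ (fun p : cg_prod S U => fexp_eval (f p.1) p.2)); last exact: c3.
  have := @fexp_near_tag (cg_prod S U) (fun p => f p.1) (x, u)
    (continuous_compose (@cg_fst_continuous S U) c1)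
    (continuous_compose (@cg_fst_continuous S U) c2).
  apply: filterS => p /= e'; rewrite fexp_eval_sigma_retract //.
  by rewrite e' e.
apply: (@near_eq_continuous _ _ _ (fun p : cg_prod S U => fexp_eval (f x0) p.2)).
  have := @fexp_near_tag (cg_prod S U) (fun p => f p.1) (x, u)
    (continuous_compose (@cg_fst_continuous S U) c1)
    (continuous_compose (@cg_fst_continuous S U) c2).
  apply: filterS => p /= e'; rewrite /g sigma_retract_neq //.
  by rewrite e'.
apply: (continuous_compose (@cg_snd_continuous S U)).
exact: fexp_eval_cts.
Qed.


Definition fexp_mk (a b : state Y) (f : U -> path Y) (cf : continuous f)
  (hf : forall u, src (f u) = a /\ tgt (f u) = b) : fexp_path.
Proof.
refine (existT _ (a, b) (cg_mk (U := U) (V := paths_between a b)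
  (f := fun u => exist _ (f u) (mem_set (hf u))) _)).
exact: cg_sub_continuous.
Defined.

Lemma fexp_mkE (a b : state Y) (f : U -> path Y) (cf : continuous f)
  (hf : forall u, src (f u) = a /\ tgt (f u) = b) u :
  fexp_eval (fexp_mk cf hf) u = f u.
Proof. by []. Qed.

Lemma fexp_link (p : cg_composable fexp_src fexp_tgt) u :
  tgt (fexp_eval (cfst p) u) = src (fexp_eval (csnd p) u).
Proof. by rewrite tgt_fexp_eval src_fexp_eval; exact: composableP. Qed.

Lemma fexp_comp_subproof1 (p : cg_composable fexp_src fexp_tgt) :
  continuous (fun u => pconcat (fexp_link p u)).
Proof.
apply: (@continuous_compose _ _ _ (fun u => compair (fexp_link p u)));
  last exact: pcomp_continuous.
by apply: compair_continuous; exact: fexp_eval_cts.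
Qed.

Lemma fexp_comp_subproof2 (p : cg_composable fexp_src fexp_tgt) u :
  src (pconcat (fexp_link p u)) = fexp_src (cfst p) /\
  tgt (pconcat (fexp_link p u)) = fexp_tgt (csnd p).
Proof. by rewrite src_pcomp tgt_pcomp src_fexp_eval tgt_fexp_eval. Qed.

Definition fexp_comp (p : cg_composable fexp_src fexp_tgt) : fexp_path :=
  fexp_mk (@fexp_comp_subproof1 p) (@fexp_comp_subproof2 p).

Lemma fexp_comp_continuous : continuous fexp_comp.
Proof.
apply: fexp_path_continuous.
- exact: (continuous_compose (@cfst_continuous _ _ _ _) fexp_src_continuous).
- exact: (continuous_compose (@csnd_continuous _ _ _ _) fexp_tgt_continuous).
pose C := cg_composable fexp_src fexp_tgt.
apply: (@continuous_compose _ _ _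
  (fun q : cg_prod C U => compair (fexp_link q.1 q.2)));
  last exact: pcomp_continuous.
have c1 := @cg_fst_continuous C U.
have c2 := @cg_snd_continuous C U.
apply: compair_continuous; apply: fexp_eval_comp_continuous => //.
  exact: (continuous_compose c1 (@cfst_continuous _ _ _ _)).
exact: (continuous_compose c1 (@csnd_continuous _ _ _ _)).
Qed.

Definition fexp : flow.
Proof.
refine (@Flow fexp_path (state Y) fexp_src fexp_tgt fexp_comp
  fexp_src_continuous fexp_tgt_continuous fexp_comp_continuous _ _ _) => //.
move=> x y z hxy hyz h1 h2; apply: fexp_path_eq => // u.
rewrite /fexp_comp !fexp_mkE; exact: pcompA.
Defined.

Lemma fexp_pconcatE (p q : path fexp) (h : tgt p = src q) u
    (h' : tgt (fexp_eval p u) = src (fexp_eval q u)) :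
  fexp_eval (pconcat h : path fexp) u = pconcat h'.
Proof. by rewrite /pconcat /= /fexp_comp fexp_mkE; exact: pconcat_eq. Qed.

End fexp.

Section fexp_map.
Variables (U V : cgSpace) (Y Z : flow).

Section post.
Variable g : flow_mor Y Z.

Definition fexp_post_path (p : path (fexp U Y)) : path (fexp U Z).
Proof.
refine (@fexp_mk U Z (fstate g (fexp_src p)) (fstate g (fexp_tgt p))
  (fun u => fpath g (fexp_eval p u)) _ _).
  by apply: continuous_compose; [exact: fexp_eval_cts|exact: fpath_continuous].
by move=> u; rewrite src_fpath tgt_fpath src_fexp_eval tgt_fexp_eval.
Defined.

Definition fexp_post : flow_mor (fexp U Y) (fexp U Z).
Proof.
refine (@FlowMor (fexp U Y) (fexp U Z) (fstate g) fexp_post_path _ _ _ _) => //.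
  apply: fexp_path_continuous.
  - apply: (continuous_compose (@fexp_src_continuous U Y)).
    exact: discrete_dom_continuous.
  - apply: (continuous_compose (@fexp_tgt_continuous U Y)).
    exact: discrete_dom_continuous.
  exact: (continuous_compose (@fexp_eval_continuous U Y) (fpath_continuous g)).
move=> x y h h'; apply: fexp_path_eq => // u.
have hl : tgt (fexp_eval x u) = src (fexp_eval y u).
  by rewrite tgt_fexp_eval src_fexp_eval.
have hr : tgt (fexp_eval (fexp_post_path x) u) =
          src (fexp_eval (fexp_post_path y) u).
  by rewrite tgt_fexp_eval src_fexp_eval.
rewrite (fexp_pconcatE h' hr) fexp_mkE (fexp_pconcatE h hl).
exact: fpath_pconcat.
Defined.

End post.

Section pre.
Variables (g : U -> V) (cg : continuous g).

Definition fexp_pre_path (p : path (fexp V Y)) : path (fexp U Y).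
Proof.
refine (@fexp_mk U Y (fexp_src p) (fexp_tgt p) (fun u => fexp_eval p (g u)) _ _).
  by apply: continuous_compose => //; exact: fexp_eval_cts.
by move=> u; rewrite src_fexp_eval tgt_fexp_eval.
Defined.

Definition fexp_pre : flow_mor (fexp V Y) (fexp U Y).
Proof.
refine (@FlowMor (fexp V Y) (fexp U Y) id fexp_pre_path _ _ _ _) => //.
  apply: fexp_path_continuous.
  - exact: fexp_src_continuous.
  - exact: fexp_tgt_continuous.
  apply: (@fexp_eval_comp_continuous V Y (cg_prod (fexp_path V Y) U) fst
           (fun q => g q.2)); first exact: cg_fst_continuous.
  exact: (continuous_compose (@cg_snd_continuous _ U) cg).
move=> x y h h'; apply: fexp_path_eq => // u.
have hl : tgt (fexp_eval x (g u)) = src (fexp_eval y (g u)).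
  by rewrite tgt_fexp_eval src_fexp_eval.
have hr : tgt (fexp_eval (fexp_pre_path x) u) =
          src (fexp_eval (fexp_pre_path y) u).
  by rewrite tgt_fexp_eval src_fexp_eval.
rewrite (fexp_pconcatE h' hr) fexp_mkE (fexp_pconcatE h hl).
exact: pconcat_eq.
Defined.

End pre.

Section at_point.
Variable u : U.

Definition fexp_at : flow_mor (fexp U Y) Y.
Proof.
refine (@FlowMor (fexp U Y) Y id (fun p => fexp_eval p u) _ _ _ _).
- by apply: (@fexp_eval_comp_continuous U Y (fexp_path U Y) id (fun=> u));
    [move=> x|exact: cst_continuous].
- by move=> p; rewrite src_fexp_eval.
- by move=> p; rewrite tgt_fexp_eval.
by move=> x y h h'; rewrite (fexp_pconcatE h h').
Defined.

End at_point.
End fexp_map.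

(** [box U X] is the flow U ⊠ X: it has the states of [X], and its paths are the
    formal composites of generators u ⊠ x, two of them being identified when
    every morphism from [X] to some [fexp U Y] evaluates them to the same path
    of [Y]. The topology is the k-ification of the initial one for these
    evaluations and for the source and target maps. Left adjointness to
    [fexp U] is [box_lift_unit] and [box_lift_unique]. *)
Section box.
Variables (U : cgSpace) (X : flow).

Inductive box_term : state X -> state X -> Type :=
| BoxGen (u : U) (x : path X) : box_term (src x) (tgt x)
| BoxComp a b b' c of b = b' & box_term a b & box_term b' c : box_term a c.

Section eval.
Variables (Y : flow) (phi : flow_mor X (fexp U Y)).

Let ends (a b : state X) (p : path Y) : Prop :=
  src p = fstate phi a /\ tgt p = fstate phi b.

Lemma box_gen_ends u x : ends (src x) (tgt x) (fexp_eval (fpath phi x) u).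
Proof.
by split; [rewrite src_fexp_eval -src_fpath|rewrite tgt_fexp_eval -tgt_fpath].
Qed.

Lemma box_comp_link a b b' c (p q : path Y) :
  b = b' -> ends a b p -> ends b' c q -> tgt p = src q.
Proof. by move=> -> [_ ->] [-> _]. Qed.

Lemma box_comp_ends a b b' c (p q : path Y)
    (e : b = b') (hp : ends a b p) (hq : ends b' c q) :
  ends a c (pconcat (box_comp_link e hp hq)).
Proof. by split; [rewrite src_pcomp hp.1|rewrite tgt_pcomp hq.2]. Qed.

Fixpoint box_term_eval a b (t : box_term a b) : {p : path Y | ends a b p} :=
  match t with
  | BoxGen u x => exist _ _ (box_gen_ends u x)
  | BoxComp a b b' c e t1 t2 =>
      exist _ _ (box_comp_ends e (svalP (box_term_eval t1))
                                 (svalP (box_term_eval t2)))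
  end.

End eval.

Definition box_word : Type :=
  {ab : state X * state X & box_term ab.1 ab.2}.

HB.instance Definition _ := gen_eqMixin box_word.
HB.instance Definition _ := gen_choiceMixin box_word.

Definition box_word_eval (Y : flow) (phi : flow_mor X (fexp U Y))
  (w : box_word) : path Y := sval (box_term_eval phi (projT2 w)).

Definition box_equiv (v w : box_word) : Prop :=
  projT1 v = projT1 w /\
  forall (Y : flow) (phi : flow_mor X (fexp U Y)),
    box_word_eval phi v = box_word_eval phi w.

Definition box_equivb (v w : box_word) : bool := `[< box_equiv v w >].

Lemma box_equivb_refl : reflexive box_equivb.
Proof. by move=> v; apply/asboolP. Qed.

Lemma box_equivb_sym : symmetric box_equivb.
Proof.
by move=> v w; apply/asboolP/asboolP => -[e h]; split => [|Y phi]; rewrite ?e ?h.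
Qed.

Lemma box_equivb_trans : transitive box_equivb.
Proof.
move=> v u w /asboolP[e h] /asboolP[e' h']; apply/asboolP.
by split => [|Y phi]; [rewrite e|rewrite h].
Qed.

Canonical box_equiv_rel :=
  EquivRel box_equivb box_equivb_refl box_equivb_sym box_equivb_trans.

Definition box_path : Type := {eq_quot box_equiv_rel}%qT.
HB.instance Definition _ := Choice.copy box_path {eq_quot box_equiv_rel}%qT.

Definition box_pi (w : box_word) : box_path := (\pi_({eq_quot box_equiv_rel}) w)%qT.
Definition box_repr (P : box_path) : box_word := repr (P : {eq_quot box_equiv_rel}%qT).

Lemma box_reprK P : box_pi (box_repr P) = P.
Proof. exact: reprK. Qed.

Lemma box_pi_eq v w : box_pi v = box_pi w <-> box_equiv v w.
Proof.
split; first by move=> /(@eqmodP _ box_equiv_rel)/asboolP.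
by move=> h; apply/(@eqmodP _ box_equiv_rel)/asboolP.
Qed.

Definition box_src (P : box_path) : state X := (projT1 (box_repr P)).1.
Definition box_tgt (P : box_path) : state X := (projT1 (box_repr P)).2.
Definition box_eval (Y : flow) (phi : flow_mor X (fexp U Y)) (P : box_path) :
  path Y := box_word_eval phi (box_repr P).

Lemma box_repr_pi w : box_equiv (box_repr (box_pi w)) w.
Proof. by apply/box_pi_eq; rewrite box_reprK. Qed.

Lemma box_src_pi w : box_src (box_pi w) = (projT1 w).1.
Proof. by rewrite /box_src (box_repr_pi w).1. Qed.

Lemma box_tgt_pi w : box_tgt (box_pi w) = (projT1 w).2.
Proof. by rewrite /box_tgt (box_repr_pi w).1. Qed.

Lemma box_eval_pi Y (phi : flow_mor X (fexp U Y)) w :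
  box_eval phi (box_pi w) = box_word_eval phi w.
Proof. by rewrite /box_eval (box_repr_pi w).2. Qed.

Lemma box_path_eq P Q : box_src P = box_src Q -> box_tgt P = box_tgt Q ->
  (forall Y (phi : flow_mor X (fexp U Y)), box_eval phi P = box_eval phi Q) ->
  P = Q.
Proof.
move=> e1 e2 h; rewrite -(box_reprK P) -(box_reprK Q); apply/box_pi_eq.
split=> //; move: e1 e2; rewrite /box_src /box_tgt.
by case: (projT1 _) (projT1 _) => [? ?] [? ?] /= -> ->.
Qed.

Lemma src_box_eval Y (phi : flow_mor X (fexp U Y)) P :
  src (box_eval phi P) = fstate phi (box_src P).
Proof. by rewrite /box_eval /box_word_eval; case: (box_term_eval _ _) => ? []. Qed.

Lemma tgt_box_eval Y (phi : flow_mor X (fexp U Y)) P :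
  tgt (box_eval phi P) = fstate phi (box_tgt P).
Proof. by rewrite /box_eval /box_word_eval; case: (box_term_eval _ _) => ? []. Qed.

(** [box_probe f] states continuity of [f] for that initial topology. *)
Definition box_probe (K : topologicalType) (f : K -> box_path) : Prop :=
  [/\ continuous (fun k => box_src (f k)), continuous (fun k => box_tgt (f k)) &
      forall (Y : flow) (phi : flow_mor X (fexp U Y)),
        continuous (fun k => box_eval phi (f k))].

Definition box_open (A : set box_path) : Prop :=
  forall (K : topologicalType) (f : K -> box_path),
    compact_hausdorff K -> box_probe f -> open (f @^-1` A).

Let box_openT : box_open [set: box_path].
Proof. by move=> K f _ _; rewrite preimage_setT; exact: openT. Qed.

Let box_openI : setI_closed box_open.
Proof. by move=> A B oA oB K f cK pf; apply: openI; [exact: oA|exact: oB]. Qed.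

Let box_open_bigU (I : Type) (F : I -> set box_path) :
  (forall i, box_open (F i)) -> box_open (\bigcup_i F i).
Proof.
move=> oF K f cK pf; rewrite preimage_bigcup.
by apply: bigcup_open => i _; exact: oF.
Qed.

HB.instance Definition _ :=
  isOpenTopological.Build box_path box_openT box_openI box_open_bigU.

Lemma box_openE (A : set box_path) : open A = box_open A.
Proof. by []. Qed.

Lemma box_src_continuous : continuous box_src.
Proof.
by apply/continuousP => A oA; rewrite box_openE => K f _ [c _ _];
   exact: (continuous_open c).
Qed.

Lemma box_tgt_continuous : continuous box_tgt.
Proof.
by apply/continuousP => A oA; rewrite box_openE => K f _ [_ c _];
   exact: (continuous_open c).
Qed.

Lemma box_eval_continuous Y (phi : flow_mor X (fexp U Y)) :
  continuous (box_eval phi).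
Proof.
by apply/continuousP => A oA; rewrite box_openE => K f _ [_ _ c];
   exact: (continuous_open (c Y phi)).
Qed.

Lemma box_k_space : k_space box_path.
Proof.
move=> A kA; rewrite box_openE => K f cK pf; apply: kA => //.
by apply/continuousP => B; rewrite box_openE; apply.
Qed.

Lemma box_k_diagonal : k_diagonal box_path.
Proof.
apply: k_diagonal_sep => P Q ne.
have [e1|n1] := pselect (box_src P = box_src Q); last first.
  exists (state X), box_src; split => //; first exact: discrete_k_diagonal.
  exact: box_src_continuous.
have [e2|n2] := pselect (box_tgt P = box_tgt Q); last first.
  exists (state X), box_tgt; split => //; first exact: discrete_k_diagonal.
  exact: box_tgt_continuous.
have [Y [phi nphi]] : exists Y (phi : flow_mor X (fexp U Y)),
    box_eval phi P <> box_eval phi Q.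
  apply: contrapT => h; apply: ne; apply: box_path_eq => // Y phi.
  by apply: contrapT => n; apply: h; exists Y, phi.
exists (path Y), (box_eval phi); split => //; first exact: cg_k_diagonal.
exact: box_eval_continuous.
Qed.

Definition cg_box_path : cgSpace :=
  CGSpace box_k_space (k_diagonal_wh box_k_space box_k_diagonal).

Lemma box_path_continuous (S : cgSpace) (f : S -> cg_box_path) :
  continuous (fun k => box_src (f k)) -> continuous (fun k => box_tgt (f k)) ->
  (forall Y (phi : flow_mor X (fexp U Y)),
     continuous (fun k => box_eval phi (f k))) ->
  continuous f.
Proof.
move=> c1 c2 c3; apply/continuousP => A oA; apply: cg_kspace => K c cK cc.
apply: (oA K (fun k => f (c k))) => //; split.
- exact: (continuous_compose cc c1).
- exact: (continuous_compose cc c2).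
by move=> Y phi; exact: (continuous_compose cc (c3 Y phi)).
Qed.

Definition box_word_comp (v w : box_word) (e : (projT1 v).2 = (projT1 w).1) :
    box_word :=
  existT (fun ab : state X * state X => box_term ab.1 ab.2)
    ((projT1 v).1, (projT1 w).2) (BoxComp e (projT2 v) (projT2 w)).

Let box_pairs := @cg_composable cg_box_path (state X) box_src box_tgt.

Definition box_comp (p : box_pairs) : cg_box_path :=
  box_pi (@box_word_comp (box_repr (cfst p)) (box_repr (csnd p))
    (composableP p)).

Lemma box_src_comp p : box_src (box_comp p) = box_src (cfst p).
Proof. by rewrite box_src_pi. Qed.

Lemma box_tgt_comp p : box_tgt (box_comp p) = box_tgt (csnd p).
Proof. by rewrite box_tgt_pi. Qed.

Lemma box_src_compair (x y : cg_box_path) (h : box_tgt x = box_src y) :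
  box_src (box_comp (compair h)) = box_src x.
Proof. exact: box_src_comp. Qed.

Lemma box_tgt_compair (x y : cg_box_path) (h : box_tgt x = box_src y) :
  box_tgt (box_comp (compair h)) = box_tgt y.
Proof. exact: box_tgt_comp. Qed.

Lemma box_eval_link Y (phi : flow_mor X (fexp U Y))
    (p : box_pairs) :
  tgt (box_eval phi (cfst p)) = src (box_eval phi (csnd p)).
Proof. by rewrite tgt_box_eval src_box_eval composableP. Qed.

Lemma box_eval_comp Y (phi : flow_mor X (fexp U Y)) p :
  box_eval phi (box_comp p) = pconcat (box_eval_link phi p).
Proof. by rewrite box_eval_pi; exact: pconcat_eq. Qed.

Lemma box_comp_continuous : continuous box_comp.
Proof.
apply: box_path_continuous => [||Y phi].
- rewrite (_ : (fun k => _) = fun k : box_pairs => box_src (cfst k)).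
    exact: (@continuous_compose box_pairs cg_box_path (state X) _ _
      (@cfst_continuous _ _ _ _) box_src_continuous).
  by apply/funext => p; exact: box_src_comp.
- rewrite (_ : (fun k => _) = fun k : box_pairs => box_tgt (csnd k)).
    exact: (@continuous_compose box_pairs cg_box_path (state X) _ _
      (@csnd_continuous _ _ _ _) box_tgt_continuous).
  by apply/funext => p; exact: box_tgt_comp.
rewrite (_ : (fun k => _) = fun k => pconcat (box_eval_link phi k)).
  apply: (@continuous_compose _ _ _ (fun k => compair (box_eval_link phi k)));
    last exact: pcomp_continuous.
  apply: compair_continuous.
    exact: (@continuous_compose box_pairs cg_box_path (path Y) _ _
              (@cfst_continuous _ _ _ _)
              (@box_eval_continuous Y phi)).
  exact: (@continuous_compose box_pairs cg_box_path (path Y) _ _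
              (@csnd_continuous _ _ _ _)
            (@box_eval_continuous Y phi)).
by apply/funext => p; exact: box_eval_comp.
Qed.

Definition box : flow.
Proof.
refine (@Flow cg_box_path (state X) box_src box_tgt box_comp
  box_src_continuous box_tgt_continuous box_comp_continuous _ _ _).
- exact: box_src_compair.
- exact: box_tgt_compair.
move=> x y z hxy hyz h1 h2; apply: box_path_eq => [||Y phi].
- by rewrite !box_src_compair.
- by rewrite !box_tgt_compair.
have l1 : tgt (box_eval phi x) = src (box_eval phi y).
  by rewrite tgt_box_eval src_box_eval hxy.
have l2 : tgt (box_eval phi y) = src (box_eval phi z).
  by rewrite tgt_box_eval src_box_eval hyz.
have l3 : tgt (pconcat l1) = src (box_eval phi z) by rewrite tgt_pcomp.
have l4 : tgt (box_eval phi x) = src (pconcat l2) by rewrite src_pcomp.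
rewrite !box_eval_comp.
transitivity (pconcat l3).
  by apply: pconcat_eq => //=; rewrite box_eval_comp; exact: pconcat_eq.
transitivity (pconcat l4); first exact: pcompA.
by apply: pconcat_eq => //=; rewrite box_eval_comp; exact: pconcat_eq.
Defined.

Definition box_gen (u : U) (x : path X) : path box :=
  box_pi (existT (fun ab : state X * state X => box_term ab.1 ab.2)
    (src x, tgt x) (BoxGen u x)).

Lemma src_box_gen u x : src (box_gen u x) = src x.
Proof. exact: box_src_pi. Qed.

Lemma tgt_box_gen u x : tgt (box_gen u x) = tgt x.
Proof. exact: box_tgt_pi. Qed.

Lemma box_eval_gen Y (phi : flow_mor X (fexp U Y)) u x :
  box_eval phi (box_gen u x) = fexp_eval (fpath phi x) u.
Proof. exact: box_eval_pi. Qed.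

Lemma box_eval_pconcat Y (phi : flow_mor X (fexp U Y)) (P Q : path box)
    (h : tgt P = src Q) (h' : tgt (box_eval phi P) = src (box_eval phi Q)) :
  box_eval phi (pconcat h : path box) = pconcat h'.
Proof.
by rewrite /pconcat /=; rewrite box_eval_comp; exact: pconcat_eq.
Qed.

Lemma box_gen_continuous :
  continuous (fun p : cg_prod (path X) U => box_gen p.2 p.1).
Proof.
apply: box_path_continuous => [||Y phi].
- rewrite (_ : (fun k => _) = fun k : cg_prod (path X) U => src k.1).
    exact: (continuous_compose (@cg_fst_continuous (path X) U)
             (@src_continuous X)).
  by apply/funext => p; exact: src_box_gen.
- rewrite (_ : (fun k => _) = fun k : cg_prod (path X) U => tgt k.1).
    exact: (continuous_compose (@cg_fst_continuous (path X) U)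
             (@tgt_continuous X)).
  by apply/funext => p; exact: tgt_box_gen.
rewrite (_ : (fun k => _) = fun k : cg_prod (path X) U =>
    fexp_eval (fpath phi k.1) k.2).
  apply: fexp_eval_comp_continuous; last exact: cg_snd_continuous.
  exact: (continuous_compose (@cg_fst_continuous (path X) U)
           (fpath_continuous phi)).
by apply/funext => p; exact: box_eval_gen.
Qed.

Lemma box_gen_cts x : continuous (fun u => box_gen u x).
Proof.
apply: (@continuous_compose _ (cg_prod (path X) U) _ (fun u => (x, u)) _ _
  box_gen_continuous).
by apply: cg_pair_continuous; [exact: cst_continuous|move=> u].
Qed.

Definition box_unit_path (x : path X) : path (fexp U box).
Proof.
refine (@fexp_mk U box (src x) (tgt x) (fun u => box_gen u x) _ _).
  exact: box_gen_cts.
by move=> u; rewrite src_box_gen tgt_box_gen.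
Defined.

Definition box_unit : flow_mor X (fexp U box).
Proof.
refine (@FlowMor X (fexp U box) id box_unit_path _ _ _ _) => //.
  apply: fexp_path_continuous.
  - exact: src_continuous.
  - exact: tgt_continuous.
  exact: box_gen_continuous.
move=> x y h h'; apply: fexp_path_eq => [||u].
- exact: (src_pcomp h).
- exact: (tgt_pcomp h).
have hr : tgt (fexp_eval (box_unit_path x) u) =
          src (fexp_eval (box_unit_path y) u).
  by rewrite tgt_fexp_eval src_fexp_eval.
rewrite (fexp_pconcatE h' hr) !fexp_mkE.
apply: box_path_eq => [||Y phi].
- rewrite box_src_comp /=; transitivity (src x); last by rewrite -(src_box_gen u).
  by transitivity (src (pconcat h)); [exact: src_box_gen|exact: src_pcomp].
- rewrite box_tgt_comp /=; transitivity (tgt y); last by rewrite -(tgt_box_gen u).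
  by transitivity (tgt (pconcat h)); [exact: tgt_box_gen|exact: tgt_pcomp].
rewrite box_eval_gen.
have h1 : tgt (fpath phi x) = src (fpath phi y).
  by rewrite tgt_fpath src_fpath h.
have h2 : tgt (fexp_eval (fpath phi x) u) = src (fexp_eval (fpath phi y) u).
  by rewrite tgt_fexp_eval src_fexp_eval; exact: h1.
rewrite (fpath_pconcat phi h h1) (fexp_pconcatE h1 h2).
by rewrite box_eval_comp; apply: pconcat_eq; rewrite box_eval_gen.
Defined.

Definition box_lift (Y : flow) (phi : flow_mor X (fexp U Y)) :
  flow_mor box Y.
Proof.
refine (@FlowMor box Y (fstate phi) (box_eval phi) _ _ _ _).
- exact: box_eval_continuous.
- exact: src_box_eval.
- exact: tgt_box_eval.
by move=> P Q h h'; exact: box_eval_pconcat.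
Defined.

Lemma box_lift_unit (Y : flow) (phi : flow_mor X (fexp U Y)) :
  flow_comp (fexp_post U (box_lift phi)) box_unit = phi.
Proof.
apply: flow_mor_eq => //= x; apply: fexp_path_eq => /=.
- by rewrite -[RHS]/(src (fpath phi x)) src_fpath.
- by rewrite -[RHS]/(tgt (fpath phi x)) tgt_fpath.
by move=> u; rewrite fexp_mkE /= box_eval_gen.
Qed.

Lemma box_mor_eq (Y : flow) (f g : flow_mor box Y) :
  fstate f =1 fstate g ->
  (forall u x, fpath f (box_gen u x) = fpath g (box_gen u x)) -> f = g.
Proof.
move=> e0 e1; apply: flow_mor_eq => // P.
rewrite -(box_reprK P); case: (box_repr P) => -[a b] /= t.
elim: t => {a b} [u x|a b b' c e t1 IH1 t2 IH2]; first exact: e1.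
subst b'.
pose w1 : box_word := existT (fun ab : state X * state X => box_term ab.1 ab.2)
  (a, b) t1.
pose w2 : box_word := existT (fun ab : state X * state X => box_term ab.1 ab.2)
  (b, c) t2.
have h : tgt (box_pi w1 : path box) = src (box_pi w2 : path box).
  by rewrite /= box_tgt_pi box_src_pi.
suff -> : box_pi (existT _ (a, c) (BoxComp erefl t1 t2)) = pconcat h.
  have hf : tgt (fpath f (box_pi w1)) = src (fpath f (box_pi w2)).
    by rewrite tgt_fpath src_fpath h.
  have hg : tgt (fpath g (box_pi w1)) = src (fpath g (box_pi w2)).
    by rewrite tgt_fpath src_fpath h.
  by rewrite (fpath_pconcat f h hf) (fpath_pconcat g h hg); exact: pconcat_eq.
apply: box_path_eq => [||Z phi].
- by rewrite box_src_comp /cfst /= !box_src_pi.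
- by rewrite box_tgt_comp /csnd /= !box_tgt_pi.
rewrite box_eval_comp box_eval_pi; apply: pconcat_eq.
  by rewrite [RHS]box_eval_pi.
by rewrite [RHS]box_eval_pi.
Qed.

Lemma box_lift_unique (Y : flow) (phi : flow_mor X (fexp U Y))
    (f : flow_mor box Y) :
  flow_comp (fexp_post U f) box_unit = phi -> f = box_lift phi.
Proof.
move=> <-; apply: box_mor_eq => // u x.
by rewrite /= box_eval_gen /= fexp_mkE.
Qed.

End box.

Definition box_map (U V : cgSpace) (g : U -> V) (cg : continuous g) (X : flow) :
    flow_mor (box U X) (box V X) :=
  box_lift (flow_comp (fexp_pre (box V X) cg) (box_unit V X)).

Lemma box_map_gen (U V : cgSpace) (g : U -> V) (cg : continuous g) (X : flow)
    u (x : path X) :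
  fpath (box_map cg X) (box_gen u x) = box_gen (g u) x.
Proof. by rewrite /= box_eval_gen. Qed.

Definition box_point (X : flow) : flow_mor X (box cg_point X) :=
  flow_comp (fexp_at (box cg_point X) (tt : cg_point)) (box_unit cg_point X).

Definition fexp_cst (U : cgSpace) (X : flow) : flow_mor X (fexp U X).
Proof.
refine (@FlowMor X (fexp U X) id
  (fun x => @fexp_mk U X (src x) (tgt x) (fun=> x) (@cst_continuous _ _ x)
              (fun=> conj erefl erefl)) _ _ _ _) => //.
  apply: fexp_path_continuous.
  - exact: src_continuous.
  - exact: tgt_continuous.
  exact: cg_fst_continuous.
move=> x y h h'; apply: fexp_path_eq => [||u].
- exact: (src_pcomp h).
- exact: (tgt_pcomp h).
by rewrite fexp_mkE (fexp_pconcatE h' h).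
Defined.

Definition box_point_inv (X : flow) : flow_mor (box cg_point X) X :=
  box_lift (fexp_cst cg_point X).

Lemma box_pointK (X : flow) :
  flow_comp (box_point_inv X) (box_point X) = flow_id X.
Proof. by apply: flow_mor_eq => // x; rewrite /= box_eval_gen. Qed.

Lemma box_point_invK (X : flow) :
  flow_comp (box_point X) (box_point_inv X) = flow_id (box cg_point X).
Proof. by apply: box_mor_eq => // -[] x; rewrite /= box_eval_gen. Qed.

(** [u ⊠ -]: the composite of [X ≅ {u} ⊠ X] with [{u} ⊠ X -> U ⊠ X]. *)
Definition box_at (U : cgSpace) (u : U) (X : flow) : flow_mor X (box U X) :=
  flow_comp (box_map (@cst_continuous cg_point U u) X) (box_point X).

Lemma fpath_box_at (U : cgSpace) (u : U) (X : flow) (x : path X) :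
  fpath (box_at u X) x = box_gen u x.
Proof. by rewrite /= box_eval_gen. Qed.

Lemma fstate_box_at (U : cgSpace) (u : U) (X : flow) (a : state X) :
  fstate (box_at u X) a = a.
Proof. by []. Qed.

Definition synchronized (X Y : flow) (f : flow_mor X Y) : Prop :=
  bijective (fstate f).

(** The elements of a flow are its states and its paths. *)
Definition agree (X Y : flow) (f g : flow_mor X Y) : Prop :=
  (forall a : state X, fstate f a = fstate g a) /\
  (forall x : path X, fpath f x = fpath g x).

Lemma agreeP (X Y : flow) (f g : flow_mor X Y) : agree f g <-> f = g.
Proof. by split=> [[]|->]; [exact: flow_mor_eq|split]. Qed.

Definition S_HEP (R : realType) (A X : flow) (i : flow_mor A X) : Prop :=
  synchronized i /\
  forall (Y : flow) (f : flow_mor X Y) (h : flow_mor (box (cg_interval R) A) Y),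
    agree (flow_comp h (box_at (interval0 R) A)) (flow_comp f i) ->
    exists H : flow_mor (box (cg_interval R) X) Y,
      agree (flow_comp H (box_at (interval0 R) X)) f /\
      forall t : cg_interval R,
        agree (flow_comp H (flow_comp (box_at t X) i))
              (flow_comp h (box_at t A)).

Definition is_pushout (A X Y Z : flow) (i : flow_mor A X) (f : flow_mor A Y)
    (k : flow_mor X Z) (j : flow_mor Y Z) : Prop :=
  flow_comp k i = flow_comp j f /\
  forall (W : flow) (a : flow_mor X W) (b : flow_mor Y W),
    flow_comp a i = flow_comp b f ->
    exists! c : flow_mor Z W, flow_comp c k = a /\ flow_comp c j = b.

(* Main.v *)
From HB Require Import structures.
From mathcomp Require Import all_boot all_order all_algebra.
From mathcomp Require Import all_classical all_reals.
From mathcomp Require Import topology.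
Require Import Defs.

(** Under the adjunction between [box U] and [fexp U], a homotopy on [X] is a
    morphism from [X] to the path flow [fexp (cg_interval R) W], and evaluating
    that homotopy at time [t] is composition with [fexp_at W t]. The S-homotopy
    extension property thus becomes a lifting property: a square from [i] to
    [fexp_at W 0] has a diagonal filler ([S_HEP_lift]). As for any lifting
    property, a pushout inherits it ([lifts_at_pushout]): the filler for
    the square composed with [i -> j] glues, along the pushout, with the
    homotopy given on [Y].

    Fillers say nothing about [j] being bijective on states. This comes from the
    state functor having a right adjoint, the indiscrete flow on a set, and
    hence preserving pushouts; and a pushout of a bijection of sets is a
    bijection ([synchronized_pushout]). *)

Set Implicit Arguments.
Unset Strict Implicit.
Unset Printing Implicit Defensive.

Lemma flow_compA (W X Y Z : flow) (h : flow_mor Y Z) (g : flow_mor X Y)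
    (f : flow_mor W X) :
  flow_comp h (flow_comp g f) = flow_comp (flow_comp h g) f.
Proof. exact: flow_mor_eq. Qed.

Lemma pushout_mor_eq (A X Y Z W : flow) (i : flow_mor A X) (f : flow_mor A Y)
    (k : flow_mor X Z) (j : flow_mor Y Z) (c d : flow_mor Z W) :
  is_pushout i f k j -> flow_comp c k = flow_comp d k ->
  flow_comp c j = flow_comp d j -> c = d.
Proof.
move=> [comm univ] ek ej.
have [|e [_ uniq]] := univ W (flow_comp d k) (flow_comp d j).
  by rewrite -!flow_compA comm.
by rewrite -(uniq c (conj ek ej)); exact: uniq.
Qed.

(** Morphisms from [X] to [indiscrete S] are the maps from [state X] to [S]:
    this flow has exactly one path between any two states. *)
Section indiscrete.
Variable S : discreteTopologicalType.

Let P : cgSpace := cg_discrete (discrete_topology (S * S)%type).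
Let isrc (p : P) : S := (p : S * S).1.
Let itgt (p : P) : S := (p : S * S).2.
Let icomp (p : cg_composable isrc itgt) : P := (isrc (cfst p), itgt (csnd p)).

Let isrc_continuous : continuous isrc.
Proof. exact: (@discrete_dom_continuous (discrete_topology (S * S)%type)). Qed.

Let itgt_continuous : continuous itgt.
Proof. exact: (@discrete_dom_continuous (discrete_topology (S * S)%type)). Qed.

Let pair_continuous (T : topologicalType) (f g : T -> S) :
  continuous f -> continuous g -> continuous (fun x => (f x, g x) : P).
Proof.
move=> cf cg x.
apply: (@near_eq_continuous _ _ _ (fun=> (f x, g x) : P)); last exact: cst_continuous.
apply: filterS (filterI (continuous_discrete_near x cf)
                        (continuous_discrete_near x cg)).
by move=> y [-> ->].
Qed.

Let icomp_continuous : continuous icomp.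
Proof.
apply: pair_continuous.
  exact: (continuous_compose (@cfst_continuous _ _ _ _) isrc_continuous).
exact: (continuous_compose (@csnd_continuous _ _ _ _) itgt_continuous).
Qed.

Definition indiscrete : flow.
Proof.
by refine (@Flow P S isrc itgt icomp isrc_continuous itgt_continuous
  icomp_continuous _ _ _).
Defined.

Definition to_indiscrete (X : flow) (g : state X -> S) :
  flow_mor X indiscrete.
Proof.
refine (@FlowMor X indiscrete g (fun x => (g (src x), g (tgt x)) : P) _ _ _ _) => //.
  apply: pair_continuous.
    exact: (continuous_compose (@src_continuous X) (@discrete_dom_continuous _ _ g)).
  exact: (continuous_compose (@tgt_continuous X) (@discrete_dom_continuous _ _ g)).
by move=> x y h h'; rewrite /pconcat src_pcomp tgt_pcomp.
Defined.

Lemma indiscrete_mor_eq (X : flow) (g h : flow_mor X indiscrete) :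
  fstate g =1 fstate h -> g = h.
Proof.
move=> e; apply: flow_mor_eq => // x; apply: (@injective_projections S S).
  by rewrite -[LHS]/(src (fpath g x)) src_fpath e -src_fpath.
by rewrite -[LHS]/(tgt (fpath g x)) tgt_fpath e -tgt_fpath.
Qed.

End indiscrete.

(** The inverse of [j] on states is induced, on the pushout, by the identity of
    [state Y] and by [f] after the inverse of [i]. *)
Lemma synchronized_pushout (A X Y Z : flow) (i : flow_mor A X)
    (f : flow_mor A Y) (k : flow_mor X Z) (j : flow_mor Y Z) :
  synchronized i -> is_pushout i f k j -> synchronized j.
Proof.
move=> [i' iK i'K] po; have [comm univ] := po.
have commS a : fstate k (fstate i a) = fstate j (fstate f a).
  exact: (congr1 (fun m => fstate m a) comm).
have [|c [[ck cj] _]] := univ (indiscrete (state Y))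
    (to_indiscrete (fun x => fstate f (i' x))) (to_indiscrete id).
  by apply: indiscrete_mor_eq => a /=; rewrite iK.
have ckS x : fstate c (fstate k x) = fstate f (i' x).
  exact: (congr1 (fun m => fstate m x) ck).
have cjS y : fstate c (fstate j y) = y.
  exact: (congr1 (fun m => fstate m y) cj).
exists (fstate c) => // z.
suff e : to_indiscrete (fun z => fstate j (fstate c z)) = to_indiscrete id.
  exact: (congr1 (fun m => fstate m z) e).
apply: (pushout_mor_eq po); apply: indiscrete_mor_eq => x /=.
  by rewrite ckS -commS i'K.
by rewrite cjS.
Qed.

Lemma box_lift_at (U : cgSpace) (X Y : flow) (phi : flow_mor X (fexp U Y))
    (u : U) :
  flow_comp (box_lift phi) (box_at u X) = flow_comp (fexp_at Y u) phi.
Proof.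
apply: flow_mor_eq => // x.
by rewrite -[LHS]/(fpath (box_lift phi) (fpath (box_at u X) x)) fpath_box_at
  /= box_eval_gen.
Qed.

(** The point [u] guarantees that equality on states can be read off from the
    evaluations: for empty [U] there are none. *)
Lemma fexp_mor_eq (U : cgSpace) (u : U) (X Y : flow)
    (g h : flow_mor X (fexp U Y)) :
  (forall v, flow_comp (fexp_at Y v) g = flow_comp (fexp_at Y v) h) -> g = h.
Proof.
move=> e.
have eS a : fstate g a = fstate h a by exact: (congr1 (fun m => fstate m a) (e u)).
apply: flow_mor_eq => // x; apply: fexp_path_eq => [||v].
- by rewrite -[LHS]/(src (fpath g x)) src_fpath eS -src_fpath.
- by rewrite -[LHS]/(tgt (fpath g x)) tgt_fpath eS -tgt_fpath.
exact: (congr1 (fun m => fpath m x) (e v)).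
Qed.

(** The left lifting property of [i] against the evaluations at [u]. *)
Definition lifts_at (U : cgSpace) (u : U) (A X : flow) (i : flow_mor A X) :
    Prop :=
  forall (W : flow) (f : flow_mor X W) (h : flow_mor A (fexp U W)),
    flow_comp (fexp_at W u) h = flow_comp f i ->
    exists2 H : flow_mor X (fexp U W),
      flow_comp (fexp_at W u) H = f & flow_comp H i = h.

Lemma S_HEP_lift (R : realType) (A X : flow) (i : flow_mor A X) :
  S_HEP R i <-> synchronized i /\ lifts_at (interval0 R) i.
Proof.
have liftE Y V (h : flow_mor (box (cg_interval R) V) Y) :
    h = box_lift (flow_comp (fexp_post _ h) (box_unit _ V)).
  exact: box_lift_unique.
split=> -[syn ext]; split=> // W f h.
  move=> e0; have [|H [H0 Hi]] := ext W f (box_lift h).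
    by apply/agreeP; rewrite box_lift_at.
  move/agreeP: H0; rewrite (liftE _ _ H) box_lift_at.
  set H' := flow_comp _ (box_unit _ X) => H0; exists H' => //.
  apply: (fexp_mor_eq (interval0 R)) => t.
  rewrite flow_compA -!box_lift_at -flow_compA -liftE.
  exact/agreeP/Hi.
move=> /agreeP; rewrite (liftE _ _ h) box_lift_at.
set h' := flow_comp _ (box_unit _ A) => e0.
have [H H0 Hi] := ext W f h' e0.
exists (box_lift H); split=> [|t]; apply/agreeP; first by rewrite box_lift_at.
by rewrite flow_compA !box_lift_at -flow_compA Hi.
Qed.

(** The given homotopy [h] on [Y] and the filler on [X] agree on [A], so they
    glue on [Z]. Evaluating the glued morphism at [u] gives back [g], because
    both restrict to the same morphisms on [X] and on [Y]. *)
Lemma lifts_at_pushout (U : cgSpace) (u : U) (A X Y Z : flow)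
    (i : flow_mor A X) (f : flow_mor A Y)
    (k : flow_mor X Z) (j : flow_mor Y Z) :
  lifts_at u i -> is_pushout i f k j -> lifts_at u j.
Proof.
move=> lift po W g h e0; have [comm univ] := po.
have [|H H0 Hi] := lift W (flow_comp g k) (flow_comp h f).
  by rewrite flow_compA e0 -!flow_compA comm.
have [c [[ck cj] _]] := univ _ _ _ Hi.
exists c => //; apply: (pushout_mor_eq po); rewrite -flow_compA.
  by rewrite ck.
by rewrite cj.
Qed.

Theorem corollary9p8 (R : realType) (A X Y Z : flow)
    (i : flow_mor A X) (f : flow_mor A Y)
    (k : flow_mor X Z) (j : flow_mor Y Z) :
  S_HEP R i -> is_pushout i f k j -> S_HEP R j.
Proof.
move=> /S_HEP_lift[syn lift] po; apply/S_HEP_lift; split.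
  exact: synchronized_pushout syn po.
exact: lifts_at_pushout lift po.
Qed.
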